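(* Let $(b_n)_{n\ge1}$ be a sequence in $(1,\infty)$ such that $b_n/n$ is non-decreasing and tends to $\infty$. Then \[ \limsup_{n\to\infty}\frac1{b_n}\sum_{k=1}^n\mathsf a'_k=\infty\ \text{a.e.}\quad\Longleftrightarrow\quad \sum_{n\ge1}\frac{1}{b_n\log b_n}=\infty, \] and if the series converges, then $\lim_{n\to\infty}\frac1{b_n}\sum_{k=1}^n\mathsf a'_k=0$ almost everywhere.
   Context: $I=(0,1]$, $\lambda$ is Lebesgue measure on $I$ (''a.e.'' refers to $\lambda$), and $\mathsf a_n(x)$ denotes the $n$-th continued fraction digit of $x\in I$. $\mathbb P$ is the set of primes. The prime digits are $\mathsf a'_n(x):=\mathsf a_n(x)$ if $\mathsf a_n(x)\in\mathbb P$ and $\mathsf a'_n(x):=0$ otherwise. *)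

(* Defs.v *)
From HB Require Import structures.
From mathcomp Require Import all_boot all_order all_algebra.
From mathcomp Require Import all_classical all_reals all_analysis.
Set Implicit Arguments. Unset Strict Implicit. Unset Printing Implicit Defensive.
Import Order.TTheory GRing.Theory Num.Theory.
Local Open Scope ring_scope.

(* Gauss map on [0,1]: T x = 1/x - floor(1/x); with the convention 0^-1 = 0,
   T 0 = 0. *)
Definition gauss (R : realType) (x : R) : R := x^-1 - (Num.floor (x^-1))%:~R.

(* first continued fraction digit a_1(x) = floor(1/x) (as a nat; a_1(0)=0) *)
Definition cf_digit1 (R : realType) (x : R) : nat := Num.truncn (x^-1).

(* n-th continued fraction digit (n >= 1): a_n(x) = a_1(T^(n-1) x).
   For rational x whose expansion terminates, digits beyond the length are 0. *)
Definition cf_digit (R : realType) (n : nat) (x : R) : nat :=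
  cf_digit1 (iter n.-1 (@gauss R) x).

Definition prime_digit (R : realType) (n : nat) (x : R) : nat :=
  if prime (cf_digit n x) then cf_digit n x else 0%N.

Definition prime_digit_sum (R : realType) (n : nat) (x : R) : R :=
  \sum_(1 <= k < n.+1) (prime_digit k x)%:R.

Definition ae_I (R : realType) (P : R -> Prop) : Prop :=
  (@lebesgue_measure R).-negligible [set x : R | 0 < x <= 1 /\ ~ P x].

(* Main.v *)
Require Import Defs.
From HB Require Import structures.
From mathcomp Require Import all_boot all_order all_algebra.
From mathcomp Require Import all_classical all_reals all_analysis.
From mathcomp Require Import zify ring lra.

(** Given the first n digits, with continuants q' <= q and r = q'/q in [0, 1], the next
digit is k with conditional probability (1+r)/((k+r)(k+1+r)), which lies between 1/(6k^2)
and 2/k^2. Hence a nonnegative function of the digits that is a supermartingale for all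
these kernels at once obeys Markov's inequality under Lebesgue measure; this only needs
upper bounds, obtained by subdividing intervals. By Chebyshev's bounds on dyadic blocks
of primes, a prime digit exceeds t with conditional probability of order 1/(t log t).

If the series diverges, the conditional probabilities of [M b_n < a'_n] have a divergent
sum, so this happens infinitely often for every M. If it converges, compare the sum of
the first 2^(j+1) prime digits with B = b(2^j): truncating the digits just above B, their
conditional means are O(log log B) and their conditional second moments O(B / log B), so
a one-sided Chebyshev inequality bounds the probability of exceeding a multiple of B by
O(2^j / (B log B)). These bounds are summable by Cauchy condensation, and convergence of
the same series makes 2^j log log B negligible compared with B. *)

Set Implicit Arguments. Unset Strict Implicit. Unset Printing Implicit Defensive.
Import Order.TTheory GRing.Theory Num.Theory.

(** * Chebyshev bounds on dyadic blocks *)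

Lemma prime_dvd_fact p n : prime p -> p %| n`! -> p <= n.
Proof.
move=> pr_p; elim: n => [|n IH]; first by rewrite dvdn1 => /eqP p1; rewrite p1 in pr_p.
by rewrite factS Euclid_dvdM// => /orP[/dvdn_leq->//|/IH /leqW].
Qed.

Lemma prod_primes_dvd m a b :
  (forall p, a <= p < b -> prime p -> p %| m) ->
  \prod_(a <= p < b | prime p) p %| m.
Proof.
elim: b => [|b IH] H; first by rewrite big_geq.
have [ab|ba] := leqP a b; last by rewrite big_geq.
rewrite big_mkcond big_nat_recr//= -big_mkcond/=.
have IH' : \prod_(a <= p < b | prime p) p %| m.
  by apply: IH => p /andP[ap pb]; apply: H; rewrite ap ltnW.
case: ifPn => pr_b; last by rewrite muln1.
rewrite Gauss_dvd ?IH' ?H ?ab ?leqnn//.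
rewrite coprime_sym prime_coprime// Euclid_dvd_prod//.
rewrite big_nat_cond; elim/big_ind : _ => //[[] []//|i /andP[/andP[_ ib] pr_i]].
by rewrite dvdn_prime2//; lia.
Qed.

Lemma bin_leq_exp2 n m : 'C(n, m) <= 2 ^ n.
Proof.
have [nm|mn] := leqP n.+1 m; first by rewrite bin_small.
rewrite -[2]/(1 + 1) expnDn (bigD1 (inord m : 'I_n.+1))//= inordK//.
by rewrite !exp1n !muln1 leq_addr.
Qed.

(** With [n = 2 ^ i], every prime in (n, 2n] exceeds n and divides the central binomial coefficient,
    which is at most 2^(2n). So n to the number of these primes is at most 2^(2n); compare exponents
    of 2. *)
Lemma primes_count_ub i :
  i * (\sum_((2 ^ i).+1 <= p < (2 ^ i.+1).+1 | prime p) 1) <= 2 ^ i.+1.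
Proof.
set n := 2 ^ i; have -> : 2 ^ i.+1 = n.*2 by rewrite expnS mul2n.
rewrite -(@leq_exp2l 2)// expnM -/n expn_sum.
apply: leq_trans (bin_leq_exp2 n.*2 n).
apply: (@leq_trans (\prod_(n.+1 <= p < n.*2.+1 | prime p) p)); last apply: dvdn_leq.
- rewrite big_nat_cond [leqRHS]big_nat_cond.
  by apply: leq_prod => p /andP[/andP[np _] _]; rewrite expn1 ltnW.
- by rewrite bin_gt0 -addnn leq_addr.
- apply: prod_primes_dvd => p /andP[np pn] pr_p.
  have : p %| n.*2`! by rewrite dvdn_fact// prime_gt0.
  rewrite -(@bin_fact n.*2 n); last by rewrite -addnn leq_addr.
  rewrite -addnn addnK !Euclid_dvdM// orbb => /orP[//|/prime_dvd_fact -/(_ pr_p)].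
  by rewrite leqNgt np.
Qed.

Lemma bin_central_ge n : 2 ^ n <= 'C(n.*2, n).
Proof.
elim: n => // n IH; rewrite doubleS binS expnS mul2n -addnn.
apply: leq_add; apply: (leq_trans IH); first by rewrite binS leq_addl.
by case: n {IH} => // n; rewrite [leqRHS]binS leq_addr.
Qed.

(** By Legendre's formula the exponent is the sum over k of floor(2n/p^k) - 2 floor(n/p^k). Each
    term is at most 1 and vanishes once p^k > 2n. *)
Lemma expn_logn_bin p n : prime p -> 0 < n -> p ^ logn p 'C(n.*2, n) <= n.*2.
Proof.
move=> pr_p n0; have p1 := prime_gt1 pr_p.
have nn : n <= n.*2 by rewrite -addnn leq_addr.
set T := trunc_log p n.*2.
suff H : logn p 'C(n.*2, n) <= T.
  apply: leq_trans (trunc_logP p1 _); last by rewrite double_gt0.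
  by rewrite leq_exp2l.
have := congr1 (logn p) (bin_fact nn).
have n2 : n.*2 - n = n by rewrite -addnn addnK.
rewrite n2 !lognM ?fact_gt0 ?muln_gt0 ?fact_gt0 ?bin_gt0// !logn_fact//.
(* Terms with k > n vanish since n < p^k, so both Legendre sums get the same range. *)
have ext : \sum_(1 <= k < n.+1) n %/ p ^ k = \sum_(1 <= k < n.*2.+1) n %/ p ^ k.
  rewrite [RHS](@big_cat_nat _ _ _ n.+1)//= [X in _ + X]big_nat [X in _ + X]big1 ?addn0// => k.
  by move=> /andP[nk _]; rewrite divn_small// (leq_trans nk)// ltnW// ltn_expl.
rewrite ext => E.
have : \sum_(1 <= k < n.*2.+1) n.*2 %/ p ^ k <=
  \sum_(1 <= k < n.*2.+1) ((n %/ p ^ k + n %/ p ^ k) + (k < T.+1)).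
  apply: leq_sum => k _; have pk0 : 0 < p ^ k by rewrite expn_gt0 ltnW.
  have [kT|Tk] := ltnP k T.+1.
    rewrite -ltnS ltn_divLR//.
    have e1 := divn_eq n (p ^ k); have e2 := ltn_pmod n pk0; nia.
  by rewrite divn_small//; apply: leq_trans (trunc_log_ltn _ p1) _; rewrite leq_exp2l.
rewrite !big_split/= -E [leqLHS]addnC leq_add2l => /leq_trans; apply.
rewrite -(big_mkcond (fun k => k < T.+1) (fun=> 1)) /= .
rewrite sum1_count -size_filter.
rewrite -[leqRHS](size_iota 1 T); apply: uniq_leq_size; first by rewrite filter_uniq// iota_uniq.
by move=> k; rewrite mem_filter !mem_iota add1n => /andP[-> /andP[-> _]].
Qed.

(** Each prime power in the factorisation is at most 2n, and only primes up to 2n occur. *)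
Lemma bin_central_leq n : 0 < n ->
  'C(n.*2, n) <= n.*2 ^ \sum_(1 <= p < n.*2.+1 | prime p) 1.
Proof.
move=> n0; have c0 : 0 < 'C(n.*2, n) by rewrite bin_gt0 -addnn leq_addr.
rewrite {1}(prod_prime_decomp c0) prime_decompE big_map/=.
apply: (@leq_trans (n.*2 ^ size (primes 'C(n.*2, n)))).
  rewrite -sum1_size expn_sum big_seq [in leqRHS]big_seq; apply: leq_prod => p.
  by rewrite mem_primes expn1 => /andP[pr_p _]; exact: expn_logn_bin.
rewrite leq_pexp2l ?double_gt0// sum1_count -size_filter.
apply: uniq_leq_size (primes_uniq _) _ => p.
rewrite mem_primes mem_filter mem_index_iota => /and3P[pr_p _ pC]; rewrite pr_p prime_gt0//=.
rewrite ltnS; apply: prime_dvd_fact => //.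
rewrite -(@bin_fact n.*2 n); last by rewrite -addnn leq_addr.
by rewrite dvdn_mulr.
Qed.

Lemma primes_count_lb L : 0 < L ->
  2 ^ L.-1 <= L * \sum_(1 <= p < (2 ^ L).+1 | prime p) 1.
Proof.
case: L => // L _; rewrite /= -(@leq_exp2l 2)//; set n := 2 ^ L.
rewrite expnM expnS mul2n; apply: leq_trans (bin_central_ge n) _.
by rewrite bin_central_leq// expn_gt0.
Qed.

(** Induction adding one dyadic block. Up to exponent 8 counting all integers suffices; afterwards
    [L >= 8], and passing from factor L to L+1 costs at most 9/8. *)
Lemma primes_count_total_ub L :
  L * \sum_(1 <= p < (2 ^ L).+1 | prime p) 1 <= 8 * 2 ^ L.
Proof.
elim: L => // L IH; have [L8|L8] := leqP L.+1 8.
  apply: leq_mul => //; rewrite sum1_count; apply: leq_trans (count_size _ _) _.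
  by rewrite size_iota subn1.
have := primes_count_ub L.
rewrite [in X in _ -> _ X](@big_cat_nat _ _ _ (2 ^ L).+1)//=; last by rewrite ltnS leq_exp2l.
move: IH; set u := \sum_(1 <= p < _ | _) 1; set v := \sum_(_ <= p < _ | _) 1.
rewrite expnS; move: (2 ^ L) => N; nia.
Qed.

(** Eight doublings beat the gap between the Chebyshev constants: as L + 8 <= 9L, 9L times the count
    up to 2^(L+8) is at least 128 * 2^L, while L times the count up to 2^L is at most 8 * 2^L. *)
Lemma primes_count_window L : 0 < L ->
  2 ^ L <= L * \sum_((2 ^ L).+1 <= p < (2 ^ (L + 8)).+1 | prime p) 1.
Proof.
move=> L0; have := primes_count_total_ub L.
have := @primes_count_lb (L + 8) (ltn_addr _ L0).
rewrite (@big_cat_nat _ _ _ (2 ^ L).+1 _ (2 ^ (L + 8)).+1)//=; last by rewrite ltnS leq_exp2l// leq_addr.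
set u := \sum_(1 <= p < _ | _) 1; set v := \sum_(_ <= p < _ | _) 1.
rewrite addnS/= !expnD -[2 ^ 7]/128; move: (2 ^ L) => N; nia.
Qed.

Lemma sqr_le_exp2 n : (n ^ 2 <= 2 ^ n.+1).
Proof.
elim: n => // n IH; rewrite expnS.
have [n3|n3] := leqP n 2; last by rewrite (expnS 2 n.+1); nia.
by case: n n3 {IH} => [|[|[|]]].
Qed.

Local Open Scope classical_set_scope.
Local Open Scope ring_scope.

(** * Sums over primes by dyadic blocks *)

Section PrimeSums.
Variable R : realFieldType.

Lemma sum_primes_dyadic (G B : nat -> R) l M : (0 < l)%N -> (l <= M)%N ->
  (forall i, 0 <= B i) ->
  (forall i k, (l <= i)%N -> (2 ^ i < k <= 2 ^ i.+1)%N -> G k <= B i) ->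
  \sum_((2 ^ l).+1 <= k < (2 ^ M).+1 | prime k) G k
    <= \sum_(l <= i < M) B i * (2 ^ i.+1)%:R / i%:R.
Proof.
move=> l0 lM B0 GB; elim: M lM => [|M IH]; first by rewrite leqNgt l0.
rewrite leq_eqVlt => /orP[/eqP->|]; first by rewrite !big_geq.
rewrite ltnS => lM; rewrite big_nat_recr//=.
rewrite (@big_cat_nat _ _ _ (2 ^ M).+1)//= ?ltnS ?leq_exp2l//.
apply: lerD; first exact: IH.
have M0 : (0 < M)%N := leq_trans l0 lM.
apply: (@le_trans _ _ (B M * (\sum_((2 ^ M).+1 <= k < (2 ^ M.+1).+1 | prime k) 1)%:R)).
  rewrite natr_sum mulr_sumr big_nat_cond [leRHS]big_nat_cond.
  apply: ler_sum => k /andP[/andP[k1 k2] _]; rewrite mulr1; apply: (GB M) => //.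
  by rewrite k1 -ltnS.
rewrite -mulrA ler_wpM2l// ler_pdivlMr ?ltr0n// -natrM ler_nat mulnC.
exact: primes_count_ub.
Qed.

(** Block i contributes at most 2/(i 2^i) <= 2/(l 2^i), a geometric series summed here by
    telescoping. *)
Lemma sum_primes_inv_sqr_tail l M : (0 < l)%N -> (l <= M)%N ->
  \sum_((2 ^ l).+1 <= k < (2 ^ M).+1 | prime k) (k%:R ^- 2 : R)
    <= 4 / (l%:R * (2 ^ l)%:R).
Proof.
move=> l0 lM.
have l0' : (0 : R) < l%:R by rewrite ltr0n.
apply: le_trans (@sum_primes_dyadic _ (fun i => (2 ^ i)%:R ^- 2) l M l0 lM _ _) _.
- by move=> i; rewrite invr_ge0 exprn_ge0.
- move=> i k li /andP[ik _].
  by rewrite lef_pV2 ?posrE ?exprn_gt0 ?ltr0n ?expn_gt0 ?(leq_ltn_trans _ ik)// lerXn2r ?nnegrE// ler_nat ltnW.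
apply: (@le_trans _ _ (\sum_(l <= i < M) (4 / l%:R * ((2 ^ i)%:R^-1 - (2 ^ i.+1)%:R^-1)))).
  rewrite big_nat [leRHS]big_nat; apply: ler_sum => i /andP[li _].
  have i0 : (0 : R) < i%:R by rewrite ltr0n (leq_trans l0).
  have p0 : (0 : R) < (2 ^ i)%:R by rewrite ltr0n expn_gt0.
  rewrite expnS natrM.
  have -> : 4 / l%:R * ((2 ^ i)%:R^-1 - (2%:R * (2 ^ i)%:R)^-1) = (2 / (2 ^ i)%:R) / l%:R :> R.
    by field; rewrite !gt_eqF.
  have -> : (2 ^ i)%:R ^- 2 * (2%:R * (2 ^ i)%:R) / i%:R = (2 / (2 ^ i)%:R) / i%:R :> R.
    by field; rewrite !gt_eqF.
  by rewrite ler_wpM2l ?divr_ge0// lef_pV2 ?posrE// ler_nat.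
rewrite -mulr_sumr (@telescope_sumr_eq _ _ _ (fun i => - (2 ^ i)%:R^-1))//; last first.
  by move=> k _; rewrite opprK addrC.
rewrite opprK invfM mulrA ler_wpM2l// ?divr_ge0//.
by rewrite gerDr oppr_le0 invr_ge0.
Qed.

(** Harmonic numbers play the role of the iterated logarithm: [harm l] has the order of log log
    (2^l). *)
Definition harm (n : nat) : R := \sum_(1 <= i < n.+1) i%:R^-1.

Lemma harm_ge1 n : (0 < n)%N -> 1 <= harm n.
Proof.
move=> n0; rewrite /harm big_nat_recl//= invr1 lerDl.
by apply: sumr_ge0 => i _; rewrite invr_ge0.
Qed.

Lemma harm_le m n : (m <= n)%N -> harm m <= harm n.
Proof.
move=> mn; rewrite /harm [leRHS](@big_cat_nat _ _ _ m.+1)//= lerDl.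
by apply: sumr_ge0 => i _; rewrite invr_ge0.
Qed.

Lemma sum_inv_le m n : \sum_(m.+1 <= i < n.+1) (i%:R^-1 : R) <= (n - m)%:R.
Proof.
have -> : (n - m)%:R = \sum_(m.+1 <= i < n.+1) (1 : R).
  by rewrite big_const_nat iter_addr_0 subSS.
rewrite [leLHS]big_nat [leRHS]big_nat; apply: ler_sum => i /andP[mi _].
by rewrite invf_le1 ?ler1n ?ltr0n// (leq_ltn_trans _ mi).
Qed.

(** Upper half of Mertens' estimate: block i contributes at most 2/i, and the prime 2 is covered by
    the summand 1. *)
Lemma sum_primes_inv l : (0 < l)%N ->
  \sum_(1 <= k < (2 ^ l).+1 | prime k) (k%:R^-1 : R) <= 1 + 2 * harm l.
Proof.
move=> l0.
rewrite (@big_cat_nat _ _ _ 3)//=; last by rewrite ltnS -[X in (X <= _)%N](expn1 2) leq_exp2l.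
apply: lerD.
  rewrite big_mkcond big_nat_recr// big_nat1/= add0r.
  by rewrite invf_le1// ler1n.
apply: le_trans (@sum_primes_dyadic _ (fun i => (2 ^ i)%:R^-1) 1 l isT l0 _ _) _.
- by move=> i; rewrite invr_ge0.
- move=> i k _ /andP[ik _].
  by rewrite lef_pV2 ?posrE ?ltr0n ?expn_gt0 ?(leq_ltn_trans _ ik)// ler_nat ltnW.
rewrite /harm big_nat_recr//= mulrDr mulr_sumr.
apply: ler_wpDr; first by rewrite mulr_ge0// invr_ge0.
rewrite big_nat [leRHS]big_nat; apply: ler_sum => i /andP[i0 _].
have p0 : (2 ^ i)%:R != 0 :> R by rewrite pnatr_eq0 -lt0n expn_gt0.
by rewrite expnS natrM mulrCA [(_^-1 * _)]mulVf// mulr1.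
Qed.

Lemma sum_primes_split (f : nat -> R) l K : (forall k, 0 <= f k) ->
  exists2 M, (l <= M)%N & \sum_(1 <= k < K | prime k) f k <=
    \sum_(1 <= k < (2 ^ l).+1 | prime k) f k +
    \sum_((2 ^ l).+1 <= k < (2 ^ M).+1 | prime k) f k.
Proof.
move=> f0; exists (l + K)%N; first exact: leq_addr.
rewrite -big_cat_nat//=; last by rewrite ltnS leq_exp2l// leq_addr.
have [K1|K1] := leqP K 1.
  by rewrite big_geq//; apply: sumr_ge0.
rewrite [leRHS](@big_cat_nat _ _ _ K)//=.
  by rewrite lerDl; apply: sumr_ge0.
  exact: ltnW.
apply: leqW; apply: leq_trans (ltnW (ltn_expl K (isT : 1 < 2)%N)) _.
by rewrite leq_exp2l// leq_addl.
Qed.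

(** Below 2^l the terms are 1/k, summing to at most 1 + 2 [harm l]; above, 2^l times the tail is at
    most 4/l <= 4. *)
Lemma sum_primes_trunc1 l K : (0 < l)%N ->
  \sum_(1 <= k < K | prime k) ((minn k (2 ^ l))%:R * k%:R ^- 2 : R) <= 7 * harm l.
Proof.
move=> l0; have Q0 : (0 : R) < (2 ^ l)%:R by rewrite ltr0n expn_gt0.
have [k|M lM H] := @sum_primes_split (fun k => (minn k (2 ^ l))%:R * k%:R ^- 2) l K.
  by rewrite mulr_ge0// invr_ge0 exprn_ge0.
apply: (le_trans H); have h1 := harm_ge1 l0.
apply: (@le_trans _ _ ((1 + 2 * harm l) + 4)); last by lra.
apply: lerD.
  apply: le_trans (sum_primes_inv l0).
  rewrite big_nat_cond [leRHS]big_nat_cond; apply: ler_sum => k /andP[/andP[k0 _] _].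
  have k0' : (0 : R) < k%:R by rewrite ltr0n.
  rewrite -[leRHS](_ : k%:R * k%:R ^- 2 = _); last by field; rewrite gt_eqF.
  by rewrite ler_wpM2r ?invr_ge0 ?exprn_ge0// ler_nat geq_minl.
apply: (@le_trans _ _ ((2 ^ l)%:R * (\sum_((2 ^ l).+1 <= k < (2 ^ M).+1 | prime k) (k%:R ^- 2 : R)))).
  rewrite mulr_sumr; apply: ler_sum => k _.
  by rewrite ler_wpM2r ?invr_ge0 ?exprn_ge0// ler_nat geq_minr.
apply: le_trans (ler_wpM2l (ltW Q0) (sum_primes_inv_sqr_tail l0 lM)) _.
have l0' : (0 : R) < l%:R by rewrite ltr0n.
have -> : (2 ^ l)%:R * (4 / (l%:R * (2 ^ l)%:R)) = 4 / l%:R :> R by field; rewrite !gt_eqF.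
by rewrite ler_pdivrMr// ler_peMr// ler1n.
Qed.

(** Below 2^l every term is at most 1 and the prime count gives 8 * 2^l / l; the tail above adds 4 *
    2^l / l. *)
Lemma sum_primes_trunc2 l K : (0 < l)%N ->
  \sum_(1 <= k < K | prime k) ((minn k (2 ^ l))%:R ^+ 2 * k%:R ^- 2 : R)
    <= 12 * (2 ^ l)%:R / l%:R.
Proof.
move=> l0; have Q0 : (0 : R) < (2 ^ l)%:R by rewrite ltr0n expn_gt0.
have l0' : (0 : R) < l%:R by rewrite ltr0n.
have [k|M lM H] := @sum_primes_split (fun k => (minn k (2 ^ l))%:R ^+ 2 * k%:R ^- 2) l K.
  by rewrite mulr_ge0// ?invr_ge0 exprn_ge0.
apply: (le_trans H).
have -> : 12 * (2 ^ l)%:R / l%:R = 8 * (2 ^ l)%:R / l%:R + (2 ^ l)%:R ^+ 2 * (4 / (l%:R * (2 ^ l)%:R)) :> R.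
  by field; rewrite !gt_eqF.
apply: lerD.
  apply: (@le_trans _ _ ((\sum_(1 <= k < (2 ^ l).+1 | prime k) 1)%:R)); last first.
    rewrite ler_pdivlMr// -!natrM ler_nat mulnC; exact: primes_count_total_ub.
  rewrite natr_sum.
  rewrite [leLHS]big_nat_cond [leRHS]big_nat_cond; apply: ler_sum => k /andP[/andP[k0 _] _].
  have k0' : (0 : R) < k%:R by rewrite ltr0n.
  by rewrite ler_pdivrMr ?exprn_gt0// mul1r lerXn2r ?nnegrE// ler_nat geq_minl.
apply: le_trans (ler_wpM2l (exprn_ge0 2 (ltW Q0)) (sum_primes_inv_sqr_tail l0 lM)).
rewrite mulr_sumr; apply: ler_sum => k _.
by rewrite ler_wpM2r ?invr_ge0 ?exprn_ge0// lerXn2r ?nnegrE// ler_nat geq_minr.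
Qed.

Lemma sum_primes_inv_sqr_window L : (0 < L)%N ->
  (4 ^ 8 * (2 ^ L)%:R * L%:R)^-1 <=
  \sum_((2 ^ L).+1 <= k < (2 ^ (L + 8)).+1 | prime k) (k%:R ^- 2 : R).
Proof.
move=> L0; have Q0 : (0 : R) < (2 ^ L)%:R by rewrite ltr0n expn_gt0.
have l0' : (0 : R) < L%:R by rewrite ltr0n.
apply: (@le_trans _ _ ((2 ^ (L + 8))%:R ^- 2 *
   (\sum_((2 ^ L).+1 <= k < (2 ^ (L + 8)).+1 | prime k) 1)%:R)).
  have -> : (4 ^ 8 * (2 ^ L)%:R * L%:R)^-1 = (2 ^ (L + 8))%:R ^- 2 * ((2 ^ L)%:R / L%:R) :> R.
    rewrite expnD natrM (_ : (2 ^ 8)%:R = 2 ^+ 8); last by rewrite natrX.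
    by field; rewrite !gt_eqF.
  rewrite ler_wpM2l ?invr_ge0 ?exprn_ge0//.
  by rewrite ler_pdivrMr// -natrM ler_nat mulnC; exact: primes_count_window.
rewrite natr_sum mulr_sumr big_nat_cond [leRHS]big_nat_cond.
apply: ler_sum => k /andP[/andP[k1 k2] _]; rewrite mulr1.
have k0 : (0 < k)%N by apply: leq_ltn_trans k1.
by rewrite lef_pV2 ?posrE ?exprn_gt0 ?ltr0n ?expn_gt0// lerXn2r ?nnegrE// ler_nat -ltnS.
Qed.

End PrimeSums.

(** * Outer bounds for Lebesgue measure *)

Section OuterBound.
Variable R : realType.

Lemma bounded_series_tail (t : nat -> R) (S : R) : (forall k, 0 <= t k) ->
  (forall n, \sum_(0 <= k < n) t k <= S) ->
  forall e, 0 < e -> exists m, forall n, \sum_(m <= k < n) t k <= e.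
Proof.
move=> t0 tS e e0; pose A := [set \sum_(0 <= k < n) t k | n in [set: nat]].
have supA : has_sup A.
  by split; [exists 0, 0%N => //; rewrite big_geq | exists S => _ [n _ <-]; exact: tS].
have [_ [m _ <-] mS] := sup_adherent e0 supA.
exists m => n; have [mn|nm] := leqP m n; last by rewrite big_geq ?ltW// ltnW.
have : \sum_(0 <= k < n) t k <= sup A by apply: ub_le_sup; [case: supA | exists n].
rewrite (@big_cat_nat _ _ _ m)//=; lra.
Qed.

(* The events below are only bounded from above, so a measurable superset is enough and
   their own measurability is never needed. *)
Definition outer_le (A : set R) (c : R) :=
  exists M : set R, [/\ measurable M, A `<=` M & (lebesgue_measure M <= c%:E)%E].

Lemma outer_leS A B c c' : A `<=` B -> c <= c' -> outer_le B c -> outer_le A c'.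
Proof.
move=> AB cc' [M [mM BM Mc]]; exists M; split => //; first exact: subset_trans BM.
by rewrite (le_trans Mc)// lee_fin.
Qed.

Lemma outer_le_bigcup (A : set R) (F : nat -> set R) (c : nat -> R) C :
  A `<=` \bigcup_k F k -> (forall k, 0 <= c k) -> (forall k, outer_le (F k) (c k)) ->
  (forall K, \sum_(0 <= k < K) c k <= C) -> outer_le A C.
Proof.
move=> AF c0 /choice[M HM] cC; exists (\bigcup_k M k); split.
- by apply: bigcup_measurable => k _; case: (HM k).
- by apply: subset_trans AF _; apply: subset_bigcup => k _; case: (HM k).
have mM k : measurable (M k) by case: (HM k).
apply: le_trans (measure_sigma_subadditive (@lebesgue_measure R) mM _ (@subset_refl _ _)) _.
  by apply: bigcup_measurable => k _; exact: mM.
apply: lime_le; first by apply: is_cvg_nneseries => k _ _; exact: measure_ge0.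
apply: nearW => K; apply: (@le_trans _ _ (\sum_(0 <= k < K) (c k)%:E)%E).
  by apply: lee_sum => k _; case: (HM k).
by rewrite sumEFin lee_fin.
Qed.

Lemma outer_le_negligible (A : set R) :
  (forall e, 0 < e -> outer_le A e) -> (@lebesgue_measure R).-negligible A.
Proof.
move=> H; have /choice[M HM] : forall n : nat, exists M : set R,
    [/\ measurable M, A `<=` M & (lebesgue_measure M <= (n.+1%:R^-1)%:E)%E].
  by move=> n; apply: H; rewrite invr_gt0.
have mI : measurable (\bigcap_n M n) by apply: bigcap_measurable => // n _; case: (HM n).
exists (\bigcap_n M n); split => //; last by move=> x Ax n _; case: (HM n) => _ + _; apply.
apply/eqP; rewrite eq_le measure_ge0 andbT; apply/lee_addgt0Pr => e e0; rewrite add0e.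
have [n ne] : exists n : nat, n.+1%:R^-1 < e.
  exists (Num.truncn e^-1); rewrite invf_plt ?posrE// ?ltr0n//.
  exact: truncnS_gt.
have [mMn _ Mn] := HM n.
apply: le_trans (_ : lebesgue_measure (M n) <= _)%E.
  by apply: le_measure; rewrite ?inE//; exact: bigcap_inf.
by apply: (le_trans Mn); rewrite lee_fin ltW.
Qed.

Lemma outer_le_borel_cantelli (E : nat -> set R) (t : nat -> R) S : (forall k, 0 <= t k) ->
  (forall n, \sum_(0 <= k < n) t k <= S) -> (forall k, outer_le (E k) (t k)) ->
  (@lebesgue_measure R).-negligible [set x | forall m, exists2 j, (m <= j)%N & E j x].
Proof.
move=> t0 tS Et; apply: outer_le_negligible => e e0.
have [m Hm] := bounded_series_tail t0 tS e0.
apply: (@outer_le_bigcup _ (fun k => E (m + k)%N) (fun k => t (m + k)%N)) => //.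
  by move=> x /(_ m)[j mj Ejx]; exists (j - m)%N => //; rewrite subnKC.
move=> K; apply: le_trans (Hm (m + K)%N).
have -> // : \sum_(m <= k < m + K) t k = \sum_(0 <= k < K) t (m + k)%N.
by rewrite -{1}[m]add0n big_addn addKn; under eq_bigr do rewrite addnC.
Qed.

Lemma outer_le_itv (a b : R) : a <= b -> outer_le `[a, b]%classic (b - a).
Proof.
move=> ab; exists `[a, b]%classic; split => //; rewrite lebesgue_measure_itv/=.
by rewrite lte_fin; case: ifPn => //=; rewrite lee_fin subr_ge0.
Qed.

End OuterBound.

(** * Supermartingales along the digit process *)

Section DigitProcess.
Variable R : realType.

Definition digit_weight (r : R) (k : nat) : R := (1 + r) / ((k%:R + r) * (k%:R + 1 + r)).

Lemma digit_weight_ge0 r k : 0 <= r -> 0 <= digit_weight r k.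
Proof. by move=> r0; rewrite divr_ge0 ?mulr_ge0 ?addr_ge0. Qed.

Lemma sum_digit_weight_le1 r K : 0 <= r -> \sum_(1 <= k < K) digit_weight r k <= 1.
Proof.
move=> r0; have [K1|K1] := leqP 1 K; last by rewrite big_geq// ltnW.
(* The weight of k is (1+r)/(k+r) - (1+r)/(k+1+r). *)
rewrite (@telescope_sumr_eq _ _ _ (fun k => - ((1 + r) / (k%:R + r))))//; last first.
  move=> k /andP[k1 _]; have k0 : (0 : R) < k%:R by rewrite ltr0n.
  by rewrite /digit_weight -natr1; field; rewrite !gt_eqF//; lra.
rewrite opprK divff; last by rewrite gt_eqF//; lra.
by rewrite gerDr oppr_le0 divr_ge0// addr_ge0.
Qed.

Lemma digit_weight_le r k : 0 <= r <= 1 -> (0 < k)%N -> digit_weight r k <= 2 * k%:R ^- 2.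
Proof.
move=> /andP[r0 r1] k0; have k1 : (1 : R) <= k%:R by rewrite ler1n.
rewrite ler_pdivrMr; last by rewrite mulr_gt0//; lra.
rewrite -mulrA -ler_pdivrMl// ler_pdivlMl; last by rewrite exprn_gt0//; lra.
by rewrite expr2; nra.
Qed.

Lemma digit_weight_ge r k : 0 <= r <= 1 -> (0 < k)%N -> 6^-1 * k%:R ^- 2 <= digit_weight r k.
Proof.
move=> /andP[r0 r1] k0; have k1 : (1 : R) <= k%:R by rewrite ler1n.
rewrite ler_pdivlMr; last by rewrite mulr_gt0//; lra.
rewrite -mulrA ler_pdivrMl// ler_pdivrMl; last by rewrite exprn_gt0//; lra.
by rewrite expr2; nra.
Qed.

Lemma cf_digit1_gauss (y : R) : 0 < y <= 1 ->
  [/\ (0 < cf_digit1 y)%N, 0 <= gauss y <= 1 & y = ((cf_digit1 y)%:R + gauss y)^-1].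
Proof.
move=> /andP[y0 y1]; have iy : 1 <= y^-1 by rewrite invf_ge1.
have iy0 : 0 <= y^-1 by rewrite (le_trans _ iy).
have fl : (Num.floor y^-1)%:~R = (cf_digit1 y)%:R :> R.
  rewrite /cf_digit1 truncn_floor iy0 natr_absz ger0_norm// floor_ge0//.
have /andP[h1 h2] := truncn_itv iy0.
rewrite /gauss fl; split.
- by rewrite truncn_gt0.
- rewrite -natr1 in h2; rewrite /cf_digit1; lra.
- by rewrite addrC subrK invrK.
Qed.

(** Consumes the first digit and shifts by the Gauss map, so that induction on [n] descends into
    cylinders. *)
Fixpoint run (S : Type) (step : S -> nat -> S) (n : nat) (s : S) (x : R) : S :=
  if n is n'.+1 then run step n' (step s (cf_digit1 x)) (gauss x) else s.

Lemma runE (S : Type) (step : S -> nat -> S) n s x :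
  run step n s x = foldl step s [seq cf_digit k.+1 x | k <- iota 0 n].
Proof.
elim: n s x => //= n IH s x; rewrite IH; congr foldl.
rewrite -[1%N]addn0 iotaDl -map_comp; apply: eq_map => k /=.
by rewrite /cf_digit /= -iterSr.
Qed.

Section Markov.
(** [psi n s] is the value in state [s] with [n] digits still to be read. The supermartingale
    inequality is required for every [r], that is, whatever the past digits, and uses partial sums
    instead of a series. *)
Variables (S : Type) (step : S -> nat -> S) (psi : nat -> S -> R).
Hypothesis psi_ge0 : forall n s, 0 <= psi n s.
Hypothesis psi_super : forall n s r K, 0 <= r <= 1 ->
  \sum_(1 <= k < K) digit_weight r k * psi n (step s k) <= psi n.+1 s.

(* The points with prescribed first digits form the image of [0, 1] under
   [y |-> (p + p' y) / (q + q' y)], an interval of length [1 / (q (q + q'))];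
   prescribing one more digit [k] replaces [(p, p', q, q')] by [(k p + p', p, k q + q', q)]. *)
Lemma cylinder_markov n s (p p' q q' : R) :
  (p' * q - p * q') ^+ 2 = 1 -> 0 < q -> 0 <= q' <= q ->
  outer_le [set (p + p' * y) / (q + q' * y) | y in
    [set y | 0 <= y <= 1 /\ 1 <= psi 0 (run step n s y)]] (psi n s / (q * (q + q'))).
Proof.
elim: n s p p' q q' => [|n IH] s p p' q q' det q0 /andP[q'0 q'q].
  have qq0 : 0 < q + q' by lra.
  (* If [psi 0 s < 1] the set is empty; otherwise the length of the whole cylinder is below the
     bound. *)
  have [psi1|psi1] := leP 1 (psi 0 s); last first.
    apply: (@outer_le_bigcup _ _ (fun _ => set0) (fun=> 0)) => //.
    - by move=> z [y [_ H] _]; move: H.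
    - by move=> _; exists set0; split => //; rewrite measure0.
    - by move=> K; rewrite big1 // divr_ge0// mulr_ge0// ltW.
  (* The sign of the determinant is the orientation: the image starts at p/q and extends by at most
     [l] to the right or to the left. *)
  have : (p' * q - p * q' == 1) || (p' * q - p * q' == -1) by rewrite -eqf_sqr expr1n det.
  pose l := (q * (q + q'))^-1; have l0 : 0 < l by rewrite invr_gt0 mulr_gt0.
  have key y : 0 <= y <= 1 ->
      [/\ (p + p' * y) / (q + q' * y) = p / q + (p' * q - p * q') * (y / (q * (q + q' * y))),
       0 <= y / (q * (q + q' * y)) & y / (q * (q + q' * y)) <= l].
    move=> /andP[y0 y1]; have d0 : 0 < q + q' * y by rewrite ltr_wpDr// mulr_ge0.
    split; first by field; rewrite !gt_eqF.
      by rewrite divr_ge0// mulr_ge0// ltW.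
    rewrite ler_pdivrMr ?mulr_gt0// mulrC ler_pdivlMr ?mulr_gt0//; nra.
  have lpsi : l <= psi 0 s / (q * (q + q')) by rewrite ler_peMl// ltW.
  case/orP => /eqP d.
    apply: (@outer_leS _ _ `[p / q, p / q + l]%classic (p / q + l - p / q) _); [|lra|by apply: outer_le_itv; lra].
    move=> _ [y [y01 _] <-]; have [-> h1 h2] := key y y01.
    by rewrite d mul1r /= in_itv/=; lra.
  apply: (@outer_leS _ _ `[p / q - l, p / q]%classic (p / q - (p / q - l)) _); [|lra|by apply: outer_le_itv; lra].
  move=> _ [y [y01 _] <-]; have [-> h1 h2] := key y y01.
  by rewrite d mulN1r /= in_itv/=; lra.
(* Index 0 is reserved for y = 0, whose image is the single point p/q and costs nothing; index k >=
   1 is the subcylinder of digit k. *)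
pose c k := if k is 0%N then 0 else psi n (step s k) / ((k%:R * q + q') * (k%:R * q + q' + q)).
pose F k := if k is 0%N then `[p / q, p / q]%classic else [set (k%:R * p + p' + p * y) / (k%:R * q + q' + q * y) | y in
    [set y | 0 <= y <= 1 /\ 1 <= psi 0 (run step n (step s k) y)]].
have pos k : (0 < k)%N -> q <= k%:R * q + q'.
  move=> k0; have k1 : (1 : R) <= k%:R by rewrite ler1n.
  nra.
apply: (@outer_le_bigcup _ _ F c).
- move=> _ [y [y01 H] <-].
  have [->|y0] := eqVneq y 0.
    by exists 0%N => //; rewrite /F /= in_itv/= !mulr0 !addr0 lexx.
  have y01' : 0 < y <= 1 by rewrite lt_def y0.
  have [k0 g01 yE] := cf_digit1_gauss y01'.
  exists (cf_digit1 y) => //; rewrite /F; move: H => /=.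
  move: k0 yE; case: (cf_digit1 y) => // k _ yE H.
  exists (gauss y) => //; rewrite [in RHS]yE.
  have k1 : (1 : R) <= k.+1%:R by rewrite ler1n.
  have d : 0 < k.+1%:R + gauss y by lra.
  have d' : 0 < 1 + k%:R + gauss y by rewrite -natr1 in d; lra.
  have e : 0 <= q * (1 + k%:R + gauss y) - q by rewrite -natr1 in k1; nra.
  by field; rewrite !gt_eqF//; lra.
- case=> // k; rewrite /c divr_ge0// mulr_ge0//; have := pos k.+1 isT; lra.
- case=> [|k].
    apply: (@outer_leS _ _ `[p / q, p / q]%classic (p / q - p / q) _) => //; first by rewrite subrr.
    by apply: outer_le_itv.
  have pk := pos k.+1 isT.
  apply: IH; [|lra|apply/andP; lra].
  by rewrite -det; ring.
- move=> K; have [->|K0] := posnP K.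
    by rewrite big_geq// divr_ge0// mulr_ge0//; lra.
  rewrite big_ltn// add0r.
  have r01 : 0 <= q' / q <= 1 by rewrite divr_ge0//= ?ler_pdivrMr ?mul1r// ltW.
  (* With r = q'/q, the length of subcylinder k divided by that of its parent is exactly the weight
     of k. *)
  apply: le_trans (_ : (\sum_(1 <= k < K) digit_weight (q' / q) k * psi n (step s k)) / (q * (q + q')) <= _).
    rewrite mulr_suml big_nat [leRHS]big_nat; apply: ler_sum => k /andP[k0 _].
    have pk := pos _ k0.
    rewrite le_eqVlt; apply/orP; left; apply/eqP.
    case: k k0 pk => // k _ pk; rewrite /c /digit_weight; field.
    by rewrite !gt_eqF//; lra.
  by rewrite ler_wpM2r ?psi_super// invr_ge0 mulr_ge0//; lra.
Qed.

(* Markov's inequality for [psi], which is a supermartingale along the digit process. *)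
Lemma digit_markov n s :
  outer_le [set x | 0 <= x <= 1 /\ 1 <= psi 0 (run step n s x)] (psi n s).
Proof.
have := @cylinder_markov n s 0 1 1 0; rewrite !(mulr1, mul1r, addr0, mulr0, subr0, divr1).
move=> /(_ (expr1n _ _) ltr01); rewrite lexx ler01 => /(_ isT).
apply: outer_leS => // x H; exists x => //.
by rewrite mul1r mul0r add0r addr0 divr1.
Qed.

End Markov.
End DigitProcess.

(** * Avoiding sets of digits *)

Section Logarithms.
Variable R : realType.

(** The binary length of the integer part; the successor keeps it positive, and 2^([lg t]) is the
    first power of 2 above [t] when t >= 1. *)
Definition lg (t : R) : nat := (trunc_log 2 (Num.truncn t)).+1.

Lemma lgP t : 1 <= t -> (2 ^ (lg t).-1)%:R <= t < (2 ^ lg t)%:R.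
Proof.
move=> t1; have t0 : 0 <= t by apply: le_trans t1.
have tr0 : (0 < Num.truncn t)%N by rewrite truncn_gt0.
have /andP[h1 h2] := trunc_log_bounds (isT : 1 < 2)%N tr0.
have /andP[h3 h4] := truncn_itv t0.
apply/andP; split; first by apply: le_trans h3; rewrite ler_nat.
by apply: lt_le_trans h4 _; rewrite ler_nat.
Qed.

Lemma lg_ub t : 1 <= t -> (2 ^ lg t)%:R <= 2 * t.
Proof. by move=> /lgP/andP[h _]; rewrite expnS natrM ler_wpM2l. Qed.

Lemma ln2_le1 : ln (2 : R) <= 1.
Proof. by have := @le_ln1Dx R 1; rewrite -natr1; apply; lra. Qed.

Lemma ln2_ge_half : 2^-1 <= ln (2 : R).
Proof.
rewrite -ler_expR lnK ?posrE//.
(* exp(-1/2) >= 1 - 1/2, hence exp(1/2) <= 2. *)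
have := @expR_ge1Dx R (- 2^-1); rewrite expRN.
have e0 := expR_gt0 (2^-1 : R) => h.
rewrite -(invrK (expR _)) -[leRHS]invrK lef_pV2 ?posrE ?invr_gt0//; lra.
Qed.

Lemma ln_le_lg t : 1 <= t -> ln t <= (lg t)%:R.
Proof.
move=> t1; have /andP[_ h] := lgP t1.
apply: (@le_trans _ _ (ln ((2 : R) ^+ lg t))).
  by rewrite ler_ln ?posrE ?exprn_gt0 ?(lt_le_trans _ t1)// -natrX ltW.
rewrite lnXn// -[leLHS]mulr_natl ler_piMr//; exact: ln2_le1.
Qed.

Lemma lg_le_ln t : 1 <= t -> (lg t)%:R <= 1 + 2 * ln t.
Proof.
move=> t1; have /andP[h _] := lgP t1.
have : ln ((2 : R) ^+ (lg t).-1) <= ln t.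
  by rewrite ler_ln ?posrE ?exprn_gt0 ?(lt_le_trans _ t1)// -natrX.
rewrite lnXn// -[X in X <= _ -> _]mulr_natl.
have -> : (lg t)%:R = (lg t).-1%:R + 1 :> R by rewrite natr1.
have := ln2_ge_half; have : 0 <= (lg t).-1%:R :> R by [].
move: (lg t).-1%:R (ln 2) (ln t) => a b c; nra.
Qed.

End Logarithms.

(** * Series, upper limits and products *)

Section Series.
Variable R : realType.

Lemma nneseries_lty_bounded (u : nat -> R) : (forall n, (1 <= n)%N -> 0 <= u n) ->
  (\sum_(1 <= n <oo) (u n)%:E < +oo)%E -> exists S, forall n, \sum_(1 <= k < n) u k <= S.
Proof.
move=> u0 fin; exists (fine (\sum_(1 <= n <oo) (u n)%:E)%E) => n.
have ge0 : (0 <= \sum_(1 <= n <oo) (u n)%:E)%E.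
  by apply: nneseries_ge0 => k k1 _; rewrite lee_fin u0.
rewrite -lee_fin fineK ?ge0_fin_numE// -sumEFin.
by apply: nneseries_lim_ge => k k1 _; rewrite lee_fin u0.
Qed.

Lemma bounded_nneseries_lty (u : nat -> R) S : (forall n, (1 <= n)%N -> 0 <= u n) ->
  (forall n, \sum_(1 <= k < n) u k <= S) -> (\sum_(1 <= n <oo) (u n)%:E < +oo)%E.
Proof.
move=> u0 uS; apply: le_lt_trans (ltry S).
apply: lime_le; first by apply: is_cvg_nneseries => k k1 _; rewrite lee_fin u0.
by apply: nearW => n; rewrite sumEFin lee_fin.
Qed.

Lemma limn_esup_pinfty (u : nat -> R) :
  (forall (M : R) m, exists2 n, (m <= n)%N & M <= u n) ->
  limn_esup (fun n => (u n)%:E) = +oo%E.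
Proof.
move=> H; rewrite limn_esup_lim; apply: cvg_lim => //.
rewrite (_ : esups _ = cst +oo%E); first exact: cvg_cst.
apply/funext => m /=; apply: eq_infty => M.
have [n mn Mn] := H M m.
by apply: (@le_trans _ _ (u n)%:E); [rewrite lee_fin|apply: ereal_sup_ubound; exists n].
Qed.

(** Follows from (1-x)(1+s+x) <= 1+s. It plays the role of 1-x <= exp(-x): a divergent sum forces
    the product to 0. *)
Lemma prod_compl_le (c : nat -> R) n : (forall i, 0 <= c i <= 1) ->
  (\prod_(0 <= i < n) (1 - c i)) * (1 + \sum_(0 <= i < n) c i) <= 1.
Proof.
move=> c01; elim: n => [|n IH]; first by rewrite !big_geq// addr0 mulr1.
rewrite !big_nat_recr//=.
have : 0 <= \prod_(0 <= i < n) (1 - c i).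
  by apply: prodr_ge0 => i _; have := c01 i; lra.
have : 0 <= \sum_(0 <= i < n) c i by apply: sumr_ge0 => i _; case/andP: (c01 i).
move: IH (c01 n); move: (\prod_(0 <= i < n) _) (\sum_(0 <= i < n) _) (c n) => a s x.
move=> IH /andP[x0 x1] s0 a0; apply: le_trans IH.
have -> : a * (1 - x) * (1 + (s + x)) = a * (1 + s) - (a * (x * (s + x))) by ring.
by rewrite gerDl oppr_le0 !mulr_ge0// addr_ge0.
Qed.

End Series.

(** * Avoidance probabilities and infinitely many hits *)

Section Avoidance.
Variables (R : realType) (P : nat -> nat -> bool) (c : nat -> R).
Hypothesis c01 : forall i, 0 <= c i <= 1.
Hypothesis cP : forall i, exists K0, forall r, 0 <= r <= 1 ->
  c i <= \sum_(1 <= k < K0 | P i k) digit_weight r k.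

(* State [Some i]: [i] digits read, none of them hit [P]; state [None]: [P] was hit. *)
Lemma outer_le_avoid n : outer_le [set x : R | 0 <= x <= 1 /\
    forall i, (i < n)%N -> ~~ P i (cf_digit i.+1 x)]
  (\prod_(0 <= i < n) (1 - c i)).
Proof.
pose step (s : option nat) k := if s is Some i then (if P i k then None else Some i.+1) else None.
pose psi n (s : option nat) : R := if s is Some i then \prod_(i <= k < i + n) (1 - c k) else 0.
have psi0 m s : 0 <= psi m s.
  by case: s => //= i; apply: prodr_ge0 => k _; have := c01 k; lra.
have sup m s r K : 0 <= r <= 1 ->
    \sum_(1 <= k < K) digit_weight r k * psi m (step s k) <= psi m.+1 s.
  move=> r01; have r0 : 0 <= r by case/andP: r01.
  case: s => [i|]; last by rewrite big1// => k _; rewrite mulr0.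
  have [K0 HK0] := cP i.
  rewrite /psi -addSnnS big_ltn ?leq_addr//=.
  have -> : \sum_(1 <= k < K) digit_weight r k * psi m (step (Some i) k) =
      (\sum_(1 <= k < K | ~~ P i k) digit_weight r k) * psi m (Some i.+1).
    rewrite mulr_suml [RHS]big_mkcond; apply: eq_bigr => k _ /=.
    by case: (P i k) => //=; rewrite mulr0.
  apply: ler_wpM2r => //.
  have := HK0 r r01.
  have w1 := @sum_digit_weight_le1 R r (maxn K K0) r0.
  rewrite (bigID (P i))/= in w1.
  (* Hits up to [K0] weigh at least [c i] and all weights sum to at most 1, so misses weigh at most
     1 - [c i]; this needs a common range for [K] and [K0]. *)
  have ext Q K' : (K' <= maxn K K0)%N -> \sum_(1 <= k < K' | Q k) digit_weight r k <=
     \sum_(1 <= k < maxn K K0 | Q k) digit_weight r k.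
    move=> KK; have [K1|K1] := leqP K' 1.
      by rewrite big_geq//; apply: sumr_ge0 => k _; exact: digit_weight_ge0.
    rewrite [leRHS](@big_cat_nat _ _ _ K')//= ?(ltnW K1)// lerDl.
    by apply: sumr_ge0 => k _; exact: digit_weight_ge0.
  have := ext (P i) K0 (leq_maxr _ _).
  have := ext (fun k => ~~ P i k) K (leq_maxl _ _).
  lra.
apply: outer_leS (digit_markov psi0 sup n (Some 0%N)) => //.
move=> x [x01 H]; split => //.
suff -> : run step n (Some 0%N) x = Some n by rewrite /psi addn0 big_geq.
rewrite runE; elim: n H => // n IH H.
rewrite -addn1 iotaD map_cat foldl_cat IH; last by move=> i /ltnW; exact: H.
by rewrite /= add0n ifN ?H// addn1.
Qed.

End Avoidance.

(** A divergent Borel-Cantelli lemma in which uniform conditional lower bounds replace independence: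
    for each m, the points with no hit from m on are covered by sets of measure at most 1/(1 + s),
    with s arbitrarily large. *)
Lemma digits_io (R : realType) (P : nat -> nat -> bool) (c : nat -> R) :
  (forall i, 0 <= c i <= 1) ->
  (forall i, exists K0, forall r, 0 <= r <= 1 ->
    c i <= \sum_(1 <= k < K0 | P i k) digit_weight r k) ->
  (forall S, exists n, S <= \sum_(0 <= i < n) c i) ->
  (@lebesgue_measure R).-negligible [set x : R | 0 <= x <= 1 /\
    ~ forall m, exists2 i, (m <= i)%N & P i (cf_digit i.+1 x)].
Proof.
move=> c01 cP cS.
pose F m := [set x : R | 0 <= x <= 1 /\ forall i, (m <= i)%N -> ~~ P i (cf_digit i.+1 x)].
suff : (@lebesgue_measure R).-negligible (\bigcup_m F m).
  apply: negligibleS.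
  move=> x [x01] /existsNP[m Hm]; exists m => //; split=> // i mi.
  by apply/negP => Pi; apply: Hm; exists i.
apply: negligible_bigcup => m; apply: outer_le_negligible => e e0.
(* Positions before m are left unconstrained. *)
pose c' i := if (m <= i)%N then c i else 0.
have c'01 i : 0 <= c' i <= 1 by rewrite /c'; case: ifP => // _; rewrite lexx ler01.
have c'P i : exists K0, forall r, 0 <= r <= 1 ->
    c' i <= \sum_(1 <= k < K0 | (m <= i)%N && P i k) digit_weight r k.
  rewrite /c'; case: ifP => _; first exact: cP.
  by exists 0%N => r _; rewrite big_geq.
have [n Hn] := cS (e^-1 + \sum_(0 <= i < m) c i).
have Sc' : e^-1 <= \sum_(0 <= i < n) c' i.
  have : \sum_(0 <= i < n) c i <= \sum_(0 <= i < n) c' i + \sum_(0 <= i < m) c i.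
    apply: le_trans (_ : \sum_(0 <= i < n) c' i + \sum_(0 <= i < n | (i < m)%N) c i <= _).
      rewrite [X in _ + X]big_mkcond -big_split/=; apply: ler_sum => i _; rewrite /c'.
      by case: ltnP => _; rewrite ?add0r ?addr0.
    rewrite lerD2l [leRHS](_ : _ = \sum_(0 <= i < maxn m n | (i < m)%N) c i); last first.
      by rewrite (@big_nat_widen _ _ _ 0 m (maxn m n)) ?leq_maxl.
    rewrite [leRHS](@big_cat_nat _ _ _ n)//= ?leq_maxr// lerDl.
    by apply: sumr_ge0 => i _; case/andP: (c01 i).
  lra.
apply: outer_leS (outer_le_avoid c'01 c'P n).
  by move=> x [x01 H]; split=> // i _; case: leqP => //= mi; exact: H.
have := prod_compl_le n c'01.
have pge : 0 <= \prod_(0 <= i < n) (1 - c' i).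
  by apply: prodr_ge0 => i _; have := c'01 i; lra.
move: Sc' pge; move: (\prod_(0 <= i < n) _) (\sum_(0 <= i < n) _) => a s Sc' a0 h.
have i0 : 0 < e^-1 by rewrite invr_gt0.
have : a * e^-1 <= 1 by nra.
by rewrite ler_pdivrMr// mul1r.
Qed.

(** * Sums of truncated prime digits *)

Section Truncation.
Variable R : realType.
Local Notation w := (@digit_weight R).

(** The lower bound 1/(t log t), with t = 2^L, for the probability of a prime digit above t; a
    bounded window of eight doublings already provides it. *)
Lemma prime_window_weight L r : (0 < L)%N -> 0 <= r <= 1 ->
  (6 * (4 ^ 8 * (2 ^ L)%:R * L%:R))^-1 <=
  \sum_(1 <= k < (2 ^ (L + 8)).+1 | prime k && (2 ^ L < k)%N) w r k.
Proof.
move=> L0 r01; rewrite invfM.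
apply: le_trans (ler_wpM2l _ (@sum_primes_inv_sqr_window R _ L0)) _; first by rewrite invr_ge0.
rewrite mulr_sumr [leRHS](@big_cat_nat _ _ _ (2 ^ L).+1)//=; last first.
  by rewrite ltnS leq_exp2l// leq_addr.
rewrite -[leLHS]add0r; apply: lerD.
  by apply: sumr_ge0 => k _; apply: digit_weight_ge0; case/andP: r01.
rewrite big_mkcond [leRHS]big_mkcond [leLHS]big_nat [leRHS]big_nat; apply: ler_sum => k /andP[k1 _].
rewrite k1 andbT; case: ifP => // _; apply: digit_weight_ge => //.
exact: leq_ltn_trans k1.
Qed.

(** Large digits are capped at [Q], not dropped, so a single one still brings the sum up to [Q]. *)
Definition trunc_prime (Q k : nat) : R := if prime k then (minn k Q)%:R else 0.

Lemma trunc_prime_ge0 Q k : 0 <= trunc_prime Q k.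
Proof. by rewrite /trunc_prime; case: ifP. Qed.

Lemma mean_trunc_prime l r K : (0 < l)%N -> 0 <= r <= 1 ->
  \sum_(1 <= k < K) w r k * trunc_prime (2 ^ l) k <= 14 * harm R l.
Proof.
move=> l0 r01.
apply: (@le_trans _ _ (2 * \sum_(1 <= k < K | prime k) ((minn k (2 ^ l))%:R * k%:R ^- 2 : R))); last first.
  by have := @sum_primes_trunc1 R l K l0; lra.
rewrite mulr_sumr [leRHS]big_mkcond [leLHS]big_nat [leRHS]big_nat; apply: ler_sum => k /andP[k0 _].
rewrite /trunc_prime; case: ifP => _; last by rewrite mulr0.
by rewrite [leRHS]mulrCA [leLHS]mulrC ler_wpM2l// digit_weight_le.
Qed.

Lemma sqr_trunc_prime l r K : (0 < l)%N -> 0 <= r <= 1 ->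
  \sum_(1 <= k < K) w r k * trunc_prime (2 ^ l) k ^+ 2 <= 24 * (2 ^ l)%:R / l%:R.
Proof.
move=> l0 r01.
apply: (@le_trans _ _ (2 * \sum_(1 <= k < K | prime k) ((minn k (2 ^ l))%:R ^+ 2 * k%:R ^- 2 : R))); last first.
  by have := @sum_primes_trunc2 R l K l0; rewrite -!mulrA; lra.
rewrite mulr_sumr [leRHS]big_mkcond [leLHS]big_nat [leRHS]big_nat; apply: ler_sum => k /andP[k0 _].
rewrite /trunc_prime; case: ifP => _; last by rewrite expr0n mulr0.
by rewrite [leRHS]mulrCA [leLHS]mulrC ler_wpM2l ?exprn_ge0// digit_weight_le.
Qed.

(* The two inequalities below replace the variance computation: they need the weights of
   the next digit to have sum at most 1 and the mean to be at most [m], not equalities. *)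
Lemma sqr_pos_part_add (D y : R) : 0 <= y ->
  Num.max (D + y) 0 ^+ 2 <= Num.max D 0 ^+ 2 + 2 * Num.max D 0 * y + y ^+ 2.
Proof.
move=> y0; have [D0|D0] := leP 0 D.
  by rewrite max_l ?addr_ge0// sqrrD le_eqVlt; apply/orP; left; apply/eqP; ring.
rewrite expr0n mulr0 mul0r !add0r lerXn2r ?nnegrE ?le_max ?lexx ?orbT//.
by rewrite ge_max y0 andbT gerDr ltW.
Qed.

Lemma sqr_pos_part_drift (D m : R) : 0 <= m ->
  Num.max (D - m) 0 ^+ 2 + 2 * Num.max (D - m) 0 * m <= Num.max D 0 ^+ 2.
Proof.
move=> m0; have [Dm|Dm] := leP 0 (D - m).
  rewrite max_l; last by lra.
  by rewrite -subr_ge0 (_ : _ - _ = m ^+ 2) ?sqr_ge0//; ring.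
by rewrite expr0n mulr0 mul0r addr0 sqr_ge0.
Qed.

Lemma prime_digit_sumE n (x : R) :
  prime_digit_sum n x = \sum_(0 <= k < n) (prime_digit k.+1 x)%:R.
Proof. by rewrite /prime_digit_sum big_add1. Qed.

(* If some prime digit exceeds [Q], the truncated sum is already at least [Q]; otherwise
   truncation changes nothing. *)
Lemma trunc_prime_sum_ge n Q (x : R) (B : R) : B <= Q%:R -> B < prime_digit_sum n x ->
  B <= \sum_(0 <= k < n) trunc_prime Q (cf_digit k.+1 x).
Proof.
move=> BQ BS.
have [/existsP[i /andP[pi iQ]]|] := boolP [exists i : 'I_n,
    prime (cf_digit i.+1 x) && (Q < cf_digit i.+1 x)%N].
  apply: (le_trans BQ); rewrite big_mkord (bigD1 i)//= {1}/trunc_prime pi.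
  rewrite (minn_idPr (ltnW iQ)) lerDl; apply: sumr_ge0 => k _; exact: trunc_prime_ge0.
move=> /existsPn H; apply: ltW; apply: (lt_le_trans BS).
rewrite prime_digit_sumE !big_mkord; apply: ler_sum => i _; have := H i.
rewrite /prime_digit /trunc_prime; case: ifP => //= pi; rewrite -leqNgt => iQ.
by rewrite (minn_idPl iQ).
Qed.

(** One-sided Chebyshev: the square of the positive part of the centred truncated sum, plus [V] per
    remaining digit, is a supermartingale. The means use up at most [eps * B] of the excess
    [2 * eps * B]. *)
Lemma outer_le_sum_gt l N (B eps : R) : (0 < l)%N -> 0 < eps -> 2 * eps <= 1 -> 0 < B ->
  B < (2 ^ l)%:R -> N%:R * (14 * harm R l) <= eps * B ->
  outer_le [set x | 0 <= x <= 1 /\ 2 * eps * B < prime_digit_sum N x]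
    (N%:R * (24 * (2 ^ l)%:R / l%:R) / (eps * B) ^+ 2).
Proof.
move=> l0 e0 e1 B0 BQ mean; set Q := (2 ^ l)%N in BQ *.
set m := 14 * harm R l in mean; set V := 24 * Q%:R / l%:R.
have m0 : 0 <= m by rewrite mulr_ge0//; have := harm_ge1 R l0; lra.
have V0 : 0 <= V by rewrite divr_ge0// mulr_ge0.
have eB : 0 < eps * B by rewrite mulr_gt0.
(* [D] is the truncated sum so far minus the mean bound [m] per digit read. *)
pose step (D : R) k := D + trunc_prime Q k - m.
pose psi n (D : R) := (Num.max D 0 ^+ 2 + n%:R * V) / (eps * B) ^+ 2.
have psi0 n D : 0 <= psi n D.
  apply: divr_ge0; last exact: sqr_ge0.
  by apply: addr_ge0; [exact: sqr_ge0|exact: mulr_ge0].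
have super n D r K : 0 <= r <= 1 ->
    \sum_(1 <= k < K) w r k * psi n (step D k) <= psi n.+1 D.
  move=> r01; have r0 : 0 <= r by case/andP: r01.
  rewrite /psi; under eq_bigr do rewrite mulrA.
  rewrite -mulr_suml ler_wpM2r ?invr_ge0 ?sqr_ge0//.
  set p := Num.max (D - m) 0; have p0 : 0 <= p by rewrite le_max lexx orbT.
  apply: (@le_trans _ _ (\sum_(1 <= k < K) (w r k * (p ^+ 2 + n%:R * V)
     + 2 * p * (w r k * trunc_prime Q k) + w r k * trunc_prime Q k ^+ 2))).
    apply: ler_sum => k _.
    rewrite (_ : _ + _ + _ = w r k * ((p ^+ 2 + 2 * p * trunc_prime Q k + trunc_prime Q k ^+ 2) + n%:R * V)); last by ring.
    rewrite ler_wpM2l ?digit_weight_ge0// lerD2r /step addrAC.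
    exact/sqr_pos_part_add/trunc_prime_ge0.
  rewrite !big_split/=.
  have h1 := sum_digit_weight_le1 K r0.
  have h2 := mean_trunc_prime K l0 r01.
  have h3 := sqr_trunc_prime K l0 r01.
  have h4 := sqr_pos_part_drift D m0.
  have a1 : \sum_(1 <= k < K) w r k * (p ^+ 2 + n%:R * V) <= p ^+ 2 + n%:R * V.
    by rewrite -mulr_suml ler_piMl// addr_ge0 ?sqr_ge0// mulr_ge0.
  have a2 : \sum_(1 <= k < K) 2 * p * (w r k * trunc_prime Q k) <= 2 * p * m.
    by rewrite -mulr_sumr ler_wpM2l// mulr_ge0.
  rewrite -/p in h4; rewrite -/Q -/V in h3.
  have -> : n.+1%:R * V = n%:R * V + V by rewrite -[n.+1%:R]natr1 mulrDl mul1r.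
  by apply: le_trans (lerD (lerD a1 a2) h3) _; lra.
apply: outer_leS (digit_markov psi0 super N 0).
  move=> x [x01 Sx]; split => //.
  have -> : run step N 0 x = \sum_(0 <= k < N) trunc_prime Q (cf_digit k.+1 x) - N%:R * m.
    rewrite runE; elim: N {mean Sx} => [|n IH]; first by rewrite big_geq// mul0r subr0.
    rewrite -addn1 iotaD map_cat foldl_cat IH /= add0n addn1 big_nat_recr//= /step -natr1; ring.
  (* Since [2 * eps <= 1], the level [2 * eps * B] lies below the cap [Q]. *)
  have : 2 * eps * B <= \sum_(0 <= k < N) trunc_prime Q (cf_digit k.+1 x).
    apply: trunc_prime_sum_ge => //; apply: le_trans (ltW BQ).
    by rewrite ler_piMl// ltW.
  move: (\sum_(0 <= k < N) _) => T HT.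
  have D1 : eps * B <= T - N%:R * m by lra.
  rewrite /psi mul0r addr0 max_l; last by lra.
  by rewrite ler_pdivlMr ?exprn_gt0// mul1r lerXn2r ?nnegrE//; lra.
by rewrite /psi maxxx expr0n add0r.
Qed.

End Truncation.

(** * The norming sequence *)

Section Norming.
Variables (R : realType) (b : nat -> R).
Hypothesis b_gt1 : forall n, (1 <= n)%N -> 1 < b n.
Hypothesis b_ratio : forall m n, (1 <= m)%N -> (m <= n)%N -> b m / m%:R <= b n / n%:R.
Hypothesis b_infty : (fun n => b n / n%:R) @ \oo --> +oo.

Let f n := (b n * ln (b n))^-1.

Lemma b_gt0 n : (1 <= n)%N -> 0 < b n.
Proof. by move=> /b_gt1; apply: lt_trans. Qed.

Lemma b_mono m n : (1 <= m)%N -> (m <= n)%N -> b m <= b n.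
Proof.
move=> m0 mn; have n0 := leq_trans m0 mn.
have m0' : (0 : R) < m%:R by rewrite ltr0n.
have n0' : (0 : R) < n%:R by rewrite ltr0n.
have := b_ratio m0 mn; rewrite ler_pdivrMr// => /le_trans; apply.
by rewrite mulrAC ler_pdivrMr// ler_wpM2l ?ler_nat// ltW// b_gt0.
Qed.

Lemma b_ratio_ge A : exists2 n0, (1 <= n0)%N & forall n, (n0 <= n)%N -> A <= b n / n%:R.
Proof.
have /cvgryPge/(_ A)[n0 _ H] := b_infty.
by exists n0.+1 => // n n0n; apply: H => /=; exact: ltnW.
Qed.

Lemma blnb_gt0 n : (1 <= n)%N -> 0 < b n * ln (b n).
Proof. by move=> n1; rewrite mulr_gt0 ?b_gt0 ?ln_gt0 ?b_gt1. Qed.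

Lemma inv_blnb_ge0 n : (1 <= n)%N -> 0 <= f n.
Proof. by move=> n1; rewrite invr_ge0 ltW// blnb_gt0. Qed.

Lemma inv_blnb_noninc m n : (1 <= m)%N -> (m <= n)%N -> f n <= f m.
Proof.
move=> m1 mn; have n1 := leq_trans m1 mn.
rewrite lef_pV2 ?posrE ?blnb_gt0//; apply: ler_pM.
- exact/ltW/b_gt0.
- exact/ltW/ln_gt0/b_gt1.
- exact: b_mono.
by rewrite ler_ln ?posrE ?b_gt0// b_mono.
Qed.

Lemma large_digits_io (M : R) : 1 <= M ->
  (forall S, exists n, S <= \sum_(1 <= k < n) f k) ->
  (@lebesgue_measure R).-negligible [set x : R | 0 <= x <= 1 /\
    ~ forall m, exists2 i, (m <= i)%N & M * b i.+1 < (prime_digit i.+1 x)%:R].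
Proof.
move=> M1 Hf.
have t1 i : 1 <= M * b i.+1.
  by have := b_gt1 (ltn0Sn i); nra.
pose L i := lg (M * b i.+1).
pose c i : R := (6 * (4 ^ 8 * (2 ^ L i)%:R * (L i)%:R))^-1.
have L0 i : (0 < L i)%N by [].
have c01 i : 0 <= c i <= 1.
  rewrite /c invr_ge0 !mulr_ge0//= invf_le1; last first.
    by rewrite !mulr_gt0// ltr0n ?expn_gt0.
  have : (1 : R) <= (2 ^ L i)%:R by rewrite ler1n expn_gt0.
  have : (1 : R) <= (L i)%:R by rewrite ler1n.
  move: (2 ^ L i)%:R (L i)%:R => a a'; nra.
have cP i : exists K0, forall r, 0 <= r <= 1 ->
    c i <= \sum_(1 <= k < K0 | prime k && (2 ^ L i < k)%N) digit_weight r k.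
  by exists (2 ^ (L i + 8)).+1 => r; exact: prime_window_weight.
have cS S : exists n, S <= \sum_(0 <= i < n) c i.
  (* From [n0] on, b >= 4, hence ln b >= 2 ln 2 >= 1, which absorbs additive constants into ln b. *)
  have [n0 n01 Hn0] := b_ratio_ge 4.
  have lnM_ge0 : 0 <= ln M by rewrite ln_ge0.
  (* Chosen so that [f i.+1 <= C * c i] for late i: 2^L <= 2 M b and L <= 1 + 2 ln(M b) <= (3 + 2 ln
     M) ln b. *)
  pose C := 6 * 4 ^ 8 * (2 * M) * (3 + 2 * ln M).
  have C0 : 0 < C by rewrite !mulr_gt0//; lra.
  have [n Hn] := Hf (\sum_(1 <= k < n0) f k + C * Num.max S 0).
  (* If [n <= n0], the choice of [n] forces S <= 0. *)
  exists n; have [nn0|n0n] := leqP n n0.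
    have S0 : 0 <= Num.max S 0 by rewrite le_max lexx orbT.
    have : \sum_(1 <= k < n) f k <= \sum_(1 <= k < n0) f k.
      have [n1|n1] := leqP 1 n; last first.
        rewrite [leLHS]big_geq; last exact: ltnW.
        rewrite big_nat; apply: sumr_ge0 => k /andP[k1 _].
        exact: inv_blnb_ge0.
      rewrite [leRHS](@big_cat_nat _ _ _ n)//= lerDl big_nat; apply: sumr_ge0 => k /andP[nk _].
      by apply: inv_blnb_ge0; apply: leq_trans nk.
    move=> h; have CS : C * Num.max S 0 <= 0 by lra.
    have : Num.max S 0 <= 0 by rewrite -(pmulr_rle0 _ C0).
    rewrite ge_max => /andP[h' _]; apply: (le_trans h'); apply: sumr_ge0 => i _.
    by case/andP: (c01 i).
  rewrite (@big_cat_nat _ _ _ n0 1 n _ _ n01 (ltnW n0n))/= in Hn.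
  have {}Hn : C * Num.max S 0 <= \sum_(n0 <= k < n) f k by lra.
  apply: (@le_trans _ _ (Num.max S 0)); first by rewrite le_max lexx.
  rewrite -(ler_pM2l C0); apply: (le_trans Hn).
  apply: (@le_trans _ _ (\sum_(n0.-1 <= i < n.-1) C * c i)).
    rewrite -(prednK n01) -(@prednK n); last exact: leq_trans n0n.
    rewrite big_add1 /= big_nat [leRHS]big_nat; apply: ler_sum => i /andP[n0i _].
    have n0i' : (n0 <= i.+1)%N by rewrite -(prednK n01).
    have b4 : 4 <= b i.+1.
      have := Hn0 _ n0i'; rewrite ler_pdivlMr// => /(le_trans _); apply.
      by rewrite ler_peMr// ler1n.
    have lnb1 : 1 <= ln (b i.+1).
      have : ln ((2 : R) ^+ 2) <= ln (b i.+1).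
        by rewrite ler_ln ?posrE ?exprn_gt0//; rewrite ?expr2; lra.
      by rewrite lnXn// mulr2n; have := @ln2_ge_half R; lra.
    have Lub : (L i)%:R <= (3 + 2 * ln M) * ln (b i.+1).
      apply: le_trans (lg_le_ln (t1 i)) _.
      rewrite lnM ?posrE; [nra|lra|lra].
    have pub := lg_ub (t1 i); rewrite -/(L i) in pub.
    have -> : f i.+1 = C * (C * (b i.+1 * ln (b i.+1)))^-1.
      by rewrite invfM mulrA divff ?mul1r// gt_eqF.
    rewrite ler_wpM2l ?(ltW C0)// /c.
    have p1 : 0 < C * (b i.+1 * ln (b i.+1)) by exact: mulr_gt0 C0 (blnb_gt0 (ltn0Sn i)).
    have p2 : 0 < 6 * (4 ^ 8 * (2 ^ L i)%:R * (L i)%:R) :> R.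
      by rewrite !mulr_gt0// ?ltr0n ?expn_gt0.
    rewrite lef_pV2 ?posrE//.
    rewrite [leRHS](_ : _ = 6 * (4 ^ 8 * (2 * (M * b i.+1)) * ((3 + 2 * ln M) * ln (b i.+1)))); last by rewrite /C; ring.
    rewrite ler_wpM2l//; apply: ler_pM => //; by [rewrite ler_wpM2l|rewrite mulr_ge0].
  rewrite -mulr_sumr ler_wpM2l ?(ltW C0)//.
  have n0n' : (n0.-1 <= n.-1)%N by lia.
  apply: (@le_trans _ _ (\sum_(0 <= i < n.-1) c i)).
    rewrite [leRHS](@big_cat_nat _ _ _ n0.-1)//= lerDr; apply: sumr_ge0 => i _.
    by case/andP: (c01 i).
  rewrite [leRHS](@big_cat_nat _ _ _ n.-1)//= ?leq_pred// lerDl; apply: sumr_ge0 => i _.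
  by case/andP: (c01 i).
apply: negligibleS (digits_io c01 cP cS) => x [x01 H]; split=> // H'; apply: H => m.
have [i mi /andP[pi di]] := H' m; exists i => //.
rewrite /prime_digit pi; have /andP[_ /lt_le_trans] := lgP (t1 i); apply.
by rewrite ler_nat ltnW.
Qed.

(** * Condensation along powers of two *)

Let beta j := b (2 ^ j).
Let t j := (2 ^ j)%:R * f (2 ^ j).
Let c j := beta j / (2 ^ j)%:R.

Let exp2_ge1 j : (1 <= 2 ^ j)%N. Proof. by rewrite expn_gt0. Qed.

(** The 2^n indices in (2^n, 2^(n+1)] each carry at least [f (2 ^ n.+1)], which pays for half of
    [t n.+1]. *)
Lemma condensation S : (forall n, \sum_(1 <= k < n) f k <= S) ->
  forall n, \sum_(0 <= j < n) t j <= 2 * S.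
Proof.
move=> fS n; have t0 j : 0 <= t j by rewrite mulr_ge0// inv_blnb_ge0.
have : \sum_(0 <= j < n.+1) t j <= 2 * \sum_(1 <= k < (2 ^ n).+1) f k.
  elim: n => [|n IH].
    by rewrite !big_nat1 /t expn0 mul1r ler_peMl ?inv_blnb_ge0//; lra.
  rewrite big_nat_recr//= [X in _ <= _ * X](@big_cat_nat _ _ _ (2 ^ n).+1)//=; last by rewrite ltnS leq_exp2l.
  rewrite mulrDr; apply: lerD => //.
  rewrite /t expnS natrM -mulrA ler_wpM2l//.
  have -> : (2 ^ n)%:R * f (2 * 2 ^ n) = \sum_((2 ^ n).+1 <= k < (2 * 2 ^ n).+1) f (2 * 2 ^ n).
    by rewrite big_const_nat iter_addr_0 mulr_natl; congr (_ *+ _); lia.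
  rewrite [leLHS]big_nat [leRHS]big_nat; apply: ler_sum => k /andP[k1 k2].
  by apply: inv_blnb_noninc => //; apply: leq_ltn_trans k1.
rewrite big_nat_recr//= => h; have := fS (2 ^ n).+1; have := t0 n; lra.
Qed.

Lemma dyadic_termE i : t i = (c i * ln (beta i))^-1.
Proof. by rewrite /t /f /c /beta [in RHS]mulrAC invf_div. Qed.

Lemma ratio_gt0 i : 0 < c i.
Proof. by rewrite divr_gt0 ?b_gt0// ltr0n. Qed.

Lemma ratio_mono i j : (i <= j)%N -> c i <= c j.
Proof. by move=> ij; apply: b_ratio => //; rewrite leq_exp2l. Qed.

Lemma ratio_ge A : exists j0, forall j, (j0 <= j)%N -> A <= c j.
Proof.
have [n0 _ H] := b_ratio_ge A; exists n0 => j n0j; apply: H.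
by rewrite (leq_trans n0j)// ltnW// ltn_expl.
Qed.

Lemma betaE i : beta i = (2 ^ i)%:R * c i.
Proof. by rewrite /c mulrC divfK// pnatr_eq0 -lt0n. Qed.

Lemma lg_beta_le j : 1 <= c j -> (lg (beta j) <= j + lg (c j))%N.
Proof.
move=> c1; have b1 : 1 <= beta j by apply/ltW/b_gt1.
have /andP[h _] := lgP b1; have /andP[_ h'] := lgP c1.
have : (2 ^ (lg (beta j)).-1)%:R < (2 ^ (j + lg (c j)))%:R :> R.
  by apply: le_lt_trans h _; rewrite betaE expnD natrM ltr_pM2l// ltr0n.
by rewrite ltr_nat ltn_exp2l.
Qed.

(* For [lg (c j) <= i <= j] one has [ln (beta i) <= i + lg (c j) <= 2 i], so [i^-1 <= 2 (c j) (t i)]: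
   a harmonic sum up to [j] costs at most [c j] times a tail of the convergent series. *)
Lemma harm_lg_beta m j : (1 <= m)%N -> 1 <= c j ->
  harm R (lg (beta j)) <= m%:R + 2 * (lg (c j))%:R + 2 * c j * \sum_(m <= i < j.+1) t i.
Proof.
move=> m1 c1; set K := lg (c j).
have t0 i : 0 <= t i by rewrite mulr_ge0// inv_blnb_ge0.
have cj0 := ltW (ratio_gt0 j).
apply: le_trans (harm_le R (lg_beta_le c1)) _; rewrite -/K.
have : harm R (j + K) <= harm R j + K%:R.
  rewrite /harm [leLHS](@big_cat_nat _ _ _ j.+1)//= ?ltnS ?leq_addr// lerD2l.
  by apply: le_trans (sum_inv_le R _ _) _; rewrite addKn.
suff : harm R j <= m%:R + K%:R + 2 * c j * \sum_(m <= i < j.+1) t i by lra.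
have sum0 : 0 <= 2 * c j * \sum_(m <= i < j.+1) t i.
  by apply: mulr_ge0; [exact: mulr_ge0|exact: sumr_ge0].
(* The first m + K reciprocals are bounded by 1 each; only the later ones are compared with [t]. *)
have [jmK|mKj] := leqP j (m + K).
  apply: le_trans (sum_inv_le R 0 j) _; rewrite subn0.
  by apply: (@le_trans _ _ (m + K)%:R); rewrite ?ler_nat// natrD lerDl.
rewrite /harm (@big_cat_nat _ _ _ (m + K).+1)//=; last by rewrite ltnS ltnW.
apply: lerD; first by apply: le_trans (sum_inv_le R 0 _) _; rewrite subn0 natrD.
rewrite [X in _ * X](@big_cat_nat _ _ _ (m + K).+1)//=; last 2 first.
- by rewrite leqW// leq_addr.
- by rewrite ltnS ltnW.
rewrite mulrDr ler_wpDl//.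
  by apply: mulr_ge0; [exact: mulr_ge0|exact: sumr_ge0].
rewrite mulr_sumr [leLHS]big_nat [leRHS]big_nat; apply: ler_sum => i /andP[mKi ij].
have i0 : (0 < i)%N by apply: leq_ltn_trans mKi.
have i0' : (0 : R) < i%:R by rewrite ltr0n.
have lnb0 : 0 < ln (beta i) by rewrite ln_gt0// b_gt1.
have lnb : ln (beta i) <= 2 * i%:R.
  rewrite betaE lnM ?posrE ?ratio_gt0 ?ltr0n// natrX lnXn// -[X in X + _]mulr_natl.
  have h1 : ln (c i) <= K%:R.
    apply: le_trans (ln_le_lg c1); rewrite ler_ln ?posrE ?ratio_gt0//; exact: ratio_mono.
  have h2 : (K%:R : R) <= i%:R by rewrite ler_nat; lia.
  have := ler_wpM2l (ltW i0') (ln2_le1 R); lra.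
have c20 : 0 < 2 * c j by rewrite mulr_gt0// ratio_gt0.
have -> : i%:R^-1 = 2 * c j * (2 * c j * i%:R)^-1 :> R.
  by rewrite invfM mulrA divff ?mul1r// gt_eqF.
have c2i0 : 0 < 2 * c j * i%:R by exact: mulr_gt0.
have clnb0 : 0 < c i * ln (beta i) by exact: mulr_gt0 (ratio_gt0 i) lnb0.
rewrite dyadic_termE ler_wpM2l ?(ltW c20)// lef_pV2 ?posrE//.
have -> : 2 * c j * i%:R = c j * (2 * i%:R) by ring.
by apply: ler_pM; [exact/ltW/ratio_gt0|exact: ltW|exact: ratio_mono|].
Qed.

(** The three terms of the previous bound are each at most (d/4) [c j]: m is fixed while [c j]
    grows, [lg (c j)] is logarithmic in [c j], and the tail of the condensed series is at most
    d/8. *)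
Lemma harm_lg_beta_small S : (forall n, \sum_(1 <= k < n) f k <= S) ->
  forall d, 0 < d -> exists j0, forall j, (j0 <= j)%N -> harm R (lg (beta j)) <= d * c j.
Proof.
move=> fS d d0.
have t0 i : 0 <= t i by rewrite mulr_ge0// inv_blnb_ge0.
have e0 : 0 < d / 8 by rewrite divr_gt0.
have [m0 Hm0] := bounded_series_tail t0 (condensation fS) e0.
pose q := (Num.truncn (32 / d)).+1.
have qd : 32 / d < q%:R by exact: truncnS_gt.
have [j1 Hj1] := ratio_ge (Num.max (Num.max 1 (2 ^ q)%:R) (m0.+1%:R * (4 / d))).
exists j1 => j /Hj1; rewrite !ge_max => /andP[/andP[c1 cq] cm].
apply: le_trans (harm_lg_beta (isT : 1 <= m0.+1)%N c1) _.
have tail : \sum_(m0.+1 <= i < j.+1) t i <= d / 8.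
  apply: le_trans (Hm0 j.+1); have [mj|jm] := leqP m0 j; last first.
    by rewrite !big_geq// ltnW.
  by rewrite [leRHS]big_ltn// lerDr.
have h1 : m0.+1%:R <= d / 4 * c j.
  by rewrite mulrC -ler_pdivrMr ?divr_gt0// invf_div.
have /andP[hK1 hK2] := lgP c1; move: hK1 hK2; set K := lg (c j) => hK1 hK2.
have qK : (q <= K)%N.
  by rewrite ltnW// -(@ltn_exp2l 2)// -(ltr_nat R) (le_lt_trans cq).
have h2 : 2 * K%:R <= d / 4 * c j.
  (* From q <= K one gets q K <= K^2 <= 2^(K+1), and 2^(K-1) <= [c j]; then q > 32/d yields 2K <=
     (d/4) [c j]. *)
  have : (q * K <= 4 * 2 ^ K.-1)%N.
    apply: leq_trans (leq_mul qK (leqnn K)) _; rewrite mulnn.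
    by apply: leq_trans (sqr_le_exp2 K) _; rewrite -(mulnA 2 2) -expnS.
  rewrite -(ler_nat R) !natrM => h3.
  have h4 : q%:R * K%:R <= 4 * c j by lra.
  have h5 : 32 / d * K%:R <= 4 * c j.
    by apply: le_trans h4; rewrite ler_wpM2r// ltW.
  have h6 : 32 * K%:R <= d * (4 * c j).
    by rewrite -(ler_pdivrMl _ _ d0); rewrite mulrA [d^-1 * _]mulrC.
  lra.
have h3 : 2 * c j * \sum_(m0.+1 <= i < j.+1) t i <= 2 * c j * (d / 8).
  by rewrite ler_wpM2l// mulr_ge0// ltW// ratio_gt0.
have : 0 <= d * c j by rewrite mulr_ge0 ?(ltW d0) ?(ltW (ratio_gt0 j)).
lra.
Qed.

Lemma dyadic_sum_eventually_small S (eps : R) : (forall n, \sum_(1 <= k < n) f k <= S) ->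
  0 < eps -> 2 * eps <= 1 ->
  (@lebesgue_measure R).-negligible [set x : R | 0 <= x <= 1 /\
    ~ exists m, forall j, (m <= j)%N -> prime_digit_sum (2 ^ j.+1) x <= 2 * eps * beta j].
Proof.
move=> fS e0 e1.
have t0 i : 0 <= t i by rewrite mulr_ge0// inv_blnb_ge0.
(* 2^(j+1) digits of mean at most 14 [harm] give 28 * 2^j [harm], which must stay below
   [eps * beta j]. *)
have d0 : 0 < eps / 28 by rewrite divr_gt0.
have [j0 Hj0] := harm_lg_beta_small fS d0.
pose E j := [set x : R | (j0 <= j)%N /\ 0 <= x <= 1 /\ 2 * eps * beta j < prime_digit_sum (2 ^ j.+1) x].
(* 96 = 2 * 24 * 2: from N = 2 * 2^j, the second moment constant 24, and 2^l <= 2 [beta j]. *)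
have C0 : 0 <= 96 / eps ^+ 2 by rewrite divr_ge0// sqr_ge0.
have ET j : outer_le (E j) (96 / eps ^+ 2 * t j).
  have [j0j|jj0] := leqP j0 j; last first.
    apply: (@outer_leS _ _ `[0, 0]%classic (0 - 0)); last exact: outer_le_itv.
      by move=> x [+ _]; rewrite leqNgt jj0.
    by rewrite subrr mulr_ge0.
  have b1 : 1 < beta j by apply: b_gt1.
  have b0 : 0 < beta j by apply: lt_trans b1.
  have /andP[_ bQ] := lgP (ltW b1); have Qb := lg_ub (ltW b1).
  set l := lg (beta j) in bQ Qb.
  have l0 : (0 < l)%N by [].
  have l0' : (0 : R) < l%:R by rewrite ltr0n.
  have mean : (2 ^ j.+1)%:R * (14 * harm R l) <= eps * beta j.
    have := Hj0 j j0j; rewrite -/l => h; rewrite expnS natrM betaE.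
    have := ler_wpM2l (ler0n R (2 ^ j)) h; lra.
  apply: outer_leS (outer_le_sum_gt l0 e0 e1 b0 bQ mean); first by move=> x [].
  rewrite /t /f -/(beta j) ler_pdivrMr ?exprn_gt0 ?mulr_gt0//.
  have lnb0 : 0 < ln (beta j) by rewrite ln_gt0.
  have -> : 96 / eps ^+ 2 * ((2 ^ j)%:R * (beta j * ln (beta j))^-1) * (eps * beta j) ^+ 2 =
     (2 ^ j.+1)%:R * (24 * (2 * beta j) / ln (beta j)).
    by rewrite expnS natrM; field; rewrite !gt_eqF.
  rewrite ler_wpM2l//; apply: ler_pM.
  - by rewrite mulr_ge0.
  - by rewrite invr_ge0.
  - by rewrite ler_wpM2l.
  - by rewrite lef_pV2 ?posrE//; apply: ln_le_lg; exact: ltW.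
have Et0 j : 0 <= 96 / eps ^+ 2 * t j by rewrite mulr_ge0.
have EtS n : \sum_(0 <= j < n) (96 / eps ^+ 2 * t j) <= 96 / eps ^+ 2 * (2 * S).
  by rewrite -mulr_sumr ler_wpM2l// condensation.
apply: negligibleS (outer_le_borel_cantelli Et0 EtS ET) => x [x01 H] m.
apply: contrapT => H'; apply: H; exists (maxn m j0) => j mj.
rewrite leNgt; apply/negP => lt; apply: H'; exists j; first by rewrite (leq_trans _ mj)// leq_maxl.
by split; [rewrite (leq_trans _ mj)// leq_maxr|].
Qed.

Lemma prime_digit_sum_mono m n (x : R) : (m <= n)%N -> prime_digit_sum m x <= prime_digit_sum n x.
Proof.
move=> mn; rewrite /prime_digit_sum [leRHS](@big_cat_nat _ _ _ m.+1)//= lerDl.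
exact: sumr_ge0.
Qed.

(** For 2^j <= n < 2^(j+1) the sum is at most the one up to 2^(j+1), hence at most
    [2 * eps * beta j <= 2 * eps * b n]; countably many eps suffice. *)
Lemma ae_cvg0 S : (forall n, \sum_(1 <= k < n) f k <= S) ->
  ae_I (fun x => (fun n => (b n)^-1 * prime_digit_sum n x) @ \oo --> 0).
Proof.
(* Starting at 1/2 ensures [2 * e q <= 1]. *)
move=> fS; pose e q : R := (q.+2%:R)^-1.
have eS q : 0 < e q /\ 2 * e q <= 1.
  rewrite invr_gt0; split=> //; rewrite ler_pdivrMr// mul1r ler_nat//.
have := negligible_bigcup (fun q => dyadic_sum_eventually_small fS (proj1 (eS q)) (proj2 (eS q))).
apply: negligibleS => x [/andP[x0 x1] H].
apply: contrapT => H'; apply: H; apply/cvgr0Pnorm_le => d d0.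
pose q := Num.truncn (2 / d).
have ed : 2 * e q <= d.
  have := truncnS_gt (2 / d); rewrite -/q ltr_pdivrMr// => h.
  rewrite ler_pdivrMr//; apply: ltW; apply: (lt_le_trans h).
  by rewrite mulrC ler_wpM2l ?(ltW d0)// ler_nat.
have [m Hm] : exists m, forall j, (m <= j)%N -> prime_digit_sum (2 ^ j.+1) x <= 2 * e q * beta j.
  apply: contrapT => H''; apply: H'; exists q => //; split=> //.
  by rewrite ltW.
exists (2 ^ m)%N => // n /= mn.
have n0 : (0 < n)%N by apply: leq_trans mn; rewrite expn_gt0.
have bn0 := b_gt0 n0.
have S0 : 0 <= prime_digit_sum n x by apply: sumr_ge0.
rewrite ger0_norm; last by rewrite mulr_ge0// invr_ge0 ltW.
rewrite mulrC ler_pdivrMr//; apply: le_trans (ler_wpM2r (ltW bn0) ed).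
have /andP[jn nj] := trunc_log_bounds (isT : 1 < 2)%N n0.
set j := trunc_log 2 n in jn nj.
have mj : (m <= j)%N by rewrite -ltnS -(@ltn_exp2l 2)// (leq_ltn_trans mn).
apply: le_trans (prime_digit_sum_mono x (ltnW nj)) _.
apply: (le_trans (Hm _ mj)); rewrite ler_wpM2l ?b_mono//.
by rewrite mulr_ge0// invr_ge0.
Qed.

(** A single digit above (q+1) b makes the normed sum exceed q+1; intersect over all q. *)
Lemma ae_limn_esup : (forall S, exists n, S <= \sum_(1 <= k < n) f k) ->
  ae_I (fun x => limn_esup (fun n => ((b n)^-1 * prime_digit_sum n x)%:E) = +oo%E).
Proof.
move=> fS; have q1 q : 1 <= q.+1%:R :> R by rewrite ler1n.
have := negligible_bigcup (fun q => large_digits_io (q1 q) fS).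
apply: negligibleS => x [/andP[x0 x1] H].
apply: contrapT => H'; apply: H; apply: limn_esup_pinfty => M m.
pose q := Num.truncn M.
have [i mi Mi] : exists2 i, (m <= i)%N & q.+1%:R * b i.+1 < (prime_digit i.+1 x)%:R.
  apply: contrapT => H''; apply: H'; exists q => //; split; first by rewrite x1 ltW.
  by move=> /(_ m).
exists i.+1; first exact: leqW.
have bi0 := b_gt0 (ltn0Sn i).
rewrite mulrC ler_pdivlMr//.
apply: (@le_trans _ _ (prime_digit i.+1 x)%:R).
  apply: ltW; apply: le_lt_trans Mi; rewrite ler_wpM2r// ?ltW//; exact: truncnS_gt.
by rewrite /prime_digit_sum big_nat_recr//= lerDr; apply: sumr_ge0.
Qed.

End Norming.

(** * The dichotomy *)

Lemma ae_I_exists (R : realType) (P : R -> Prop) : ae_I P -> exists2 x, 0 < x <= 1 & P x.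
Proof.
move=> aeP; apply: contrapT => H.
have /negligibleP : (@lebesgue_measure R).-negligible `]0, 1]%classic.
  apply: negligibleS aeP => x /=; rewrite in_itv/= => x01; split=> // Px.
  by apply: H; exists x.
move=> /(_ (measurable_itv _)) I0.
have := lebesgue_measure_itv (`]0, 1] : interval R).
by rewrite [LHS]I0/= lte_fin ltr01 sube0 => /esym/eqP; rewrite eqe oner_eq0.
Qed.

Theorem theorem2p6 (R : realType) (b : nat -> R)
  (hb1 : forall n, (1 <= n)%N -> 1 < b n)
  (hbmono : forall m n, (1 <= m)%N -> (m <= n)%N -> b m / m%:R <= b n / n%:R)
  (hbinf : (fun n => b n / n%:R) @ \oo --> +oo) :
  (ae_I (fun x => limn_esup (fun n => ((b n)^-1 * prime_digit_sum n x)%:E) = +oo%E)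
     <-> (\sum_(1 <= n <oo) ((b n * ln (b n))^-1)%:E = +oo)%E)
  /\
  ((\sum_(1 <= n <oo) ((b n * ln (b n))^-1)%:E < +oo)%E ->
     ae_I (fun x => (fun n => (b n)^-1 * prime_digit_sum n x) @ \oo --> 0)).
Proof.
have f0 n : (1 <= n)%N -> 0 <= (b n * ln (b n))^-1 by exact: inv_blnb_ge0.
have cvg0 : (\sum_(1 <= n <oo) ((b n * ln (b n))^-1)%:E < +oo)%E ->
    ae_I (fun x => (fun n => (b n)^-1 * prime_digit_sum n x) @ \oo --> 0).
  by move=> /(nneseries_lty_bounded f0)[S]; exact: ae_cvg0.
split=> //; split=> [sup|div].
  (* If the series converged, almost every point would have both limit 0 and upper limit infinity;
     as I has positive measure, some point would satisfy this contradiction. *)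
  apply: contrapT => /eqP; rewrite -ltey => /cvg0 lim0.
  have : ae_I (fun x : R => False).
    have := negligibleU sup lim0; apply: negligibleS => x [x01 _].
    have [e1|ne1] := pselect (limn_esup (fun n => ((b n)^-1 * prime_digit_sum n x)%:E) = +oo%E);
      last by left.
    right; split=> // lim.
    have lim' : (fun n => ((b n)^-1 * prime_digit_sum n x)%:E) @ \oo --> 0%:E.
      by apply: cvg_EFin => //; exact: nearW.
    have := is_cvg_limn_esupE (cvgP _ lim').
    by rewrite e1 (cvg_lim _ lim').
  by move=> /ae_I_exists[].
apply: ae_limn_esup => // S; apply: contrapT => /forallNP H.
have : (\sum_(1 <= n <oo) ((b n * ln (b n))^-1)%:E < +oo)%E.
  apply: (bounded_nneseries_lty f0 (S := S)) => n.
  by rewrite leNgt; apply/negP => /ltW; exact: H.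
by rewrite div ltxx.
Qed.
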